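(* Let $(X,\Sigma,\mu)$ be a complete $\sigma$-finite measure space, let $u\in L^0(\mu)$ be such that the multiplication operator $M_u:L^2(\mu)\to L^2(\mu)$, $M_uf=uf$, is bounded, and let $m\in\mathbb{N}$, $m\ge 1$. Then: (i) $M_u$ is an $m$-isometry if and only if $$(|u(x)|^2-1)^m=\sum_{k=0}^{m}(-1)^{m-k}\binom{m}{k}|u(x)|^{2k}=0\quad\text{for almost all }x\in X,$$ or equivalently $|u|=1$ $\mu$-a.e. (ii) $M_u$ is a quasi-$m$-isometry if and only if $$|u(x)|^2(|u(x)|^2-1)^m=\sum_{k=0}^{m}(-1)^{m-k}\binom{m}{k}|u(x)|^{2(k+1)}=0\quad\text{for almost all }x\in X,$$ or equivalently $|u|(1-|u|^2)=0$ $\mu$-a.e.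
   Context: $L^0(\mu)$ is the space of equivalence classes of a.e. finite-valued measurable functions on $X$; $L^2(\mu)$ is the complex $L^2$-space. Operators are bounded linear operators on an infinite-dimensional complex Hilbert space (here $L^2(\mu)$). $T$ is an $m$-isometry if $B_m=\sum_{k=0}^{m}(-1)^{m-k}\binom{m}{k}T^{*k}T^{k}=0$. $T$ is a quasi-$m$-isometry if $\sum_{k=0}^{m}(-1)^{m-k}\binom{m}{k}T^{*(k+1)}T^{k+1}=T^*B_mT=0$. *)

(* Defs.v *)
From HB Require Import structures.
From mathcomp Require Import all_boot all_order all_algebra.
From mathcomp Require Import all_classical all_reals all_analysis.
From mathcomp Require Import measurable_realfun ring lra.
From mathcomp Require Import complex.

Set Implicit Arguments.
Unset Strict Implicit.
Unset Printing Implicit Defensive.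

Import Order.TTheory GRing.Theory Num.Theory.

Local Open Scope classical_set_scope.
Local Open Scope ring_scope.

Section InnerProductOperators.
Context {C : numClosedFieldType} {V : lmodType C}.
Variable form : {dot V for Num.conj}.
Implicit Types (T S : V -> V) (f g : V).

Local Notation "''[' f , g ]" := (form f%R g%R) : ring_scope.

Definition dot_norm f : C := sqrtC '[f, f].

Definition bounded_op T :=
  exists c : C, forall f, dot_norm (T f) <= c * dot_norm f.

Definition is_adjoint T S := forall f g, '[T f, g] = '[f, S g].

(* The Hilbert adjoint T^*.  It is unique (adjointE); the default value 0 is
   only taken when T has no adjoint, which does not happen for a bounded T on
   a Hilbert space. *)
Definition adjoint T : V -> V := xget (fun=> 0) (is_adjoint T).

(* B_m = \sum_k (-1)^(m-k) 'C(m, k) T^*^k T^k *)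
Definition defect_op m T : V -> V := fun f =>
  \sum_(k < m.+1) ((-1) ^+ (m - k) * 'C(m, k)%:R) *:
    iter k (adjoint T) (iter k T f).

Definition m_isometry m T := forall f, defect_op m T f = 0.

Definition quasi_m_isometry m T := forall f,
  \sum_(k < m.+1) ((-1) ^+ (m - k) * 'C(m, k)%:R) *:
    iter k.+1 (adjoint T) (iter k.+1 T f) = 0.

Lemma dot_inj f g : (forall h, '[h, f] = '[h, g]) -> f = g.
Proof.
move=> fg; apply/eqP; rewrite -subr_eq0; apply/negPn/negP => fg0.
have := neq0_dnorm_gt0 (s := form) _ fg0.
by rewrite linearBr/= fg subrr ltxx.
Qed.

Lemma adjointE T S : is_adjoint T S -> adjoint T = S.
Proof.
move=> TS; rewrite /adjoint; case: xgetP => [S' _ TS'|/(_ S)//].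
by apply/funext => g; apply: dot_inj => h; rewrite -TS -TS'.
Qed.

Lemma adjointP T S : is_adjoint T S -> is_adjoint T (adjoint T).
Proof. by move=> TS; rewrite (adjointE TS). Qed.

Lemma adjoint_linear T : linear (adjoint T).
Proof.
rewrite /adjoint; case: xgetP => [S _ TS|_] a f g; last by rewrite scaler0 addr0.
by apply: dot_inj => h; rewrite -TS !linearPr/= -!TS.
Qed.

(* the sum defining a quasi-m-isometry is T^* B_m T *)
Lemma quasi_m_isometryE m T :
  quasi_m_isometry m T <-> forall f, adjoint T (defect_op m T (T f)) = 0.
Proof.
have eqT f : adjoint T (defect_op m T (T f)) =
    \sum_(k < m.+1) ((-1) ^+ (m - k) * 'C(m, k)%:R) *:
      iter k.+1 (adjoint T) (iter k.+1 T f).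
  pose A : {linear V -> V} := HB.pack (adjoint T)
    (GRing.isLinear.Build _ _ _ _ (adjoint T) (@adjoint_linear T)).
  rewrite -[adjoint T]/(A : V -> V) linear_sum; apply: eq_bigr => k _.
  by rewrite linearZ/= -iterSr.
by split=> h f; [rewrite eqT|rewrite -eqT].
Qed.

End InnerProductOperators.

Definition infinite_dimensional (K : fieldType) (V : lmodType K) :=
  forall (n : nat) (e : 'I_n -> V),
  exists v, forall c : 'I_n -> K, v != \sum_(i < n) c i *: e i.
Arguments infinite_dimensional {K} V.

(* C is identified with R * R, with its product (= Borel) sigma-algebra. *)
Section ComplexMeasurable.
Context (R : realType).

Local Notation Rec := (@complex.Re R).
Local Notation Imc := (@complex.Im R).

Definition complex_pair (z : R[i]) : R * R := (complex.Re z, complex.Im z).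

HB.instance Definition _ := isPointed.Build R[i] 0.

HB.instance Definition _ := @isMeasurable.Build (preimage_display complex_pair)
  R[i] (@measurable _ (g_sigma_algebra_preimageType complex_pair))
  (@measurable0 _ (g_sigma_algebra_preimageType complex_pair))
  (@measurableC _ (g_sigma_algebra_preimageType complex_pair))
  (@bigcupT_measurable _ (g_sigma_algebra_preimageType complex_pair)).

Lemma measurable_complexP d (X : measurableType d) (f : X -> R[i]) :
  measurable_fun setT f <->
  measurable_fun setT (Rec \o f) /\ measurable_fun setT (Imc \o f).
Proof.
rewrite -(measurable_fun_pairP (complex_pair \o f)); split=> mf.
  move=> _ B mB; rewrite comp_preimage; apply: mf => //.
  by exists B => //; rewrite setTI.
by move=> _ _ [B mB <-]; rewrite setTI; exact: mf.
Qed.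

Context {d} {X : measurableType d}.
Implicit Types f g : X -> R[i].

Lemma measurable_addC f g : measurable_fun setT f -> measurable_fun setT g ->
  measurable_fun setT (fun x => f x + g x).
Proof.
move=> /measurable_complexP[rf i_f] /measurable_complexP[rg ig].
apply/measurable_complexP; split.
  rewrite (_ : _ \o _ = (Rec \o f) \+ (Rec \o g)).
    exact: measurable_funD.
  by apply/funext => x /=; case: (f x); case: (g x).
rewrite (_ : _ \o _ = (Imc \o f) \+ (Imc \o g)).
  exact: measurable_funD.
by apply/funext => x /=; case: (f x); case: (g x).
Qed.

Lemma measurable_mulC f g : measurable_fun setT f -> measurable_fun setT g ->
  measurable_fun setT (fun x => f x * g x).
Proof.
move=> /measurable_complexP[rf i_f] /measurable_complexP[rg ig].
apply/measurable_complexP; split.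
  rewrite (_ : _ \o _ = ((Rec \o f) \* (Rec \o g)) \-
                        ((Imc \o f) \* (Imc \o g))).
    by apply: measurable_funB; exact: measurable_funM.
  by apply/funext => x /=; case: (f x); case: (g x).
rewrite (_ : _ \o _ = ((Rec \o f) \* (Imc \o g)) \+
                      ((Imc \o f) \* (Rec \o g))).
  by apply: measurable_funD; exact: measurable_funM.
by apply/funext => x /=; case: (f x); case: (g x).
Qed.

Lemma measurable_conjC f : measurable_fun setT f ->
  measurable_fun setT (fun x => Num.conj (f x)).
Proof.
move=> /measurable_complexP[rf i_f]; apply/measurable_complexP; split.
  by rewrite (_ : _ \o _ = Rec \o f)//; apply/funext => x /=; case: (f x).
rewrite (_ : _ \o _ = \- (Imc \o f)).
  exact: measurableT_comp.
by apply/funext => x /=; case: (f x).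
Qed.

End ComplexMeasurable.

Section L0.
Context {d} {X : measurableType d} {R : realType}.
Variable mu : {measure set X -> \bar R}.

(* Classes of a.e. equal measurable functions X -> C; an a.e. finite-valued
   function is a.e. equal to one that is finite everywhere. *)
Definition L0 : Type := {mfun_ mu, X >-> R[i]}.
HB.instance Definition _ := Choice.on L0.

(* L0 coerces to functions through the choice of a representative, so only
   a.e. statements about f : L0 are meaningful. *)
Definition L0_fun (f : L0) : X -> R[i] := repr f.
Coercion L0_fun : L0 >-> Funclass.

Definition L0_class (f : X -> R[i]) (mf : measurable_fun setT f) : L0 :=
  \pi_({mfun_ mu, X >-> R[i]})%qT (mfun_Sub (mem_set mf)).

End L0.

Section L0Theory.
Context {d} {X : measurableType d} {R : realType}.
Variable mu : {measure set X -> \bar R}.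
Implicit Types (f g h : L0 mu) (a b : R[i]).

Lemma L0P f g : {ae mu, forall x, f x = g x} -> f = g.
Proof.
move=> fg; rewrite -[f](@reprK _ {mfun_ mu, X >-> R[i]}).
rewrite -[g](@reprK _ {mfun_ mu, X >-> R[i]}).
by apply/eqP; rewrite eqmodE; apply/asboolP; apply: filterS fg.
Qed.

Lemma measurable_L0 f : measurable_fun setT f.
Proof. exact: measurable_funPT. Qed.

Lemma L0_classE (f : X -> R[i]) (mf : measurable_fun setT f) :
  {ae mu, forall x, L0_class mu mf x = f x}.
Proof.
rewrite /L0_class; set F := mfun_Sub _.
have : ae_eq_op mu (repr (\pi_({mfun_ mu, X >-> R[i]}) F)%qT) F.
  by rewrite -eqmodE reprK.
by move=> /asboolP; apply: filterS => x; apply.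
Qed.

Definition L0_zero : L0 mu := L0_class mu (@measurable_cst _ _ X R[i] setT 0).
Definition L0_scale a f : L0 mu :=
  L0_class mu (measurable_mulC (@measurable_cst _ _ X R[i] setT a) (measurable_L0 f)).
Definition L0_opp f : L0 mu := L0_scale (-1) f.
Definition L0_add f g : L0 mu :=
  L0_class mu (measurable_addC (measurable_L0 f) (measurable_L0 g)).
Definition L0_mul f g : L0 mu :=
  L0_class mu (measurable_mulC (measurable_L0 f) (measurable_L0 g)).

Lemma L0_zeroE : {ae mu, forall x, L0_zero x = 0}.
Proof. exact: L0_classE. Qed.
Lemma L0_scaleE a f : {ae mu, forall x, L0_scale a f x = a * f x}.
Proof. exact: L0_classE. Qed.
Lemma L0_oppE f : {ae mu, forall x, L0_opp f x = - f x}.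
Proof. by apply: filterS (L0_scaleE (-1) f) => x ->; rewrite mulN1r. Qed.
Lemma L0_addE f g : {ae mu, forall x, L0_add f g x = f x + g x}.
Proof. exact: L0_classE. Qed.
Lemma L0_mulE f g : {ae mu, forall x, L0_mul f g x = f x * g x}.
Proof. exact: L0_classE. Qed.

Fact L0_addA : associative L0_add.
Proof.
move=> f g h; apply: L0P.
apply: filterS2 (filterI (L0_addE f (L0_add g h)) (L0_addE g h))
  (filterI (L0_addE (L0_add f g) h) (L0_addE f g)).
by move=> x [-> ->] [-> ->]; rewrite addrA.
Qed.
Fact L0_addC : commutative L0_add.
Proof.
move=> f g; apply: L0P.
by apply: filterS2 (L0_addE f g) (L0_addE g f) => x -> ->; rewrite addrC.
Qed.
Fact L0_add0 : left_id L0_zero L0_add.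
Proof.
move=> f; apply: L0P.
by apply: filterS2 (L0_addE L0_zero f) L0_zeroE => x -> ->; rewrite add0r.
Qed.
Fact L0_addN : left_inverse L0_zero L0_opp L0_add.
Proof.
move=> f; apply: L0P.
by apply: filterS3 (L0_addE (L0_opp f) f) (L0_oppE f) L0_zeroE
  => x -> -> ->; rewrite addNr.
Qed.
HB.instance Definition _ :=
  GRing.isZmodule.Build (L0 mu) L0_addA L0_addC L0_add0 L0_addN.

Fact L0_scaleA a b f : L0_scale a (L0_scale b f) = L0_scale (a * b) f.
Proof.
apply: L0P.
by apply: filterS3 (L0_scaleE a (L0_scale b f)) (L0_scaleE b f)
  (L0_scaleE (a * b) f) => x -> -> ->; rewrite mulrA.
Qed.
Fact L0_scale1 : left_id 1 L0_scale.
Proof.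
by move=> f; apply: L0P; apply: filterS (L0_scaleE 1 f) => x ->; rewrite mul1r.
Qed.
Fact L0_scaleDr : right_distributive L0_scale +%R.
Proof.
move=> a f g; apply: L0P.
apply: filterS2 (filterI (L0_scaleE a (f + g)) (L0_addE f g))
  (filterI (L0_addE (L0_scale a f) (L0_scale a g))
    (filterI (L0_scaleE a f) (L0_scaleE a g))).
by move=> x [-> ->] [-> [-> ->]]; rewrite mulrDr.
Qed.
Fact L0_scaleDl f : {morph L0_scale^~ f : a b / a + b}.
Proof.
move=> a b; apply: L0P.
apply: filterS2 (filterI (L0_scaleE (a + b) f)
  (L0_addE (L0_scale a f) (L0_scale b f)))
  (filterI (L0_scaleE a f) (L0_scaleE b f)).
by move=> x [-> ->] [-> ->]; rewrite mulrDl.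
Qed.
HB.instance Definition _ := GRing.Zmodule_isLmodule.Build R[i] (L0 mu)
  L0_scaleA L0_scale1 L0_scaleDr L0_scaleDl.

Lemma L0_linearE a f g : {ae mu, forall x, (a *: f + g : L0 mu) x = a * f x + g x}.
Proof. by apply: filterS2 (L0_addE (a *: f) g) (L0_scaleE a f) => x -> ->. Qed.

End L0Theory.

Section ComplexIntegral.
Context {d} {X : measurableType d} {R : realType}.
Variable mu : {measure set X -> \bar R}.
Implicit Types F G : X -> R[i].

Local Notation Rec := (@complex.Re R).
Local Notation Imc := (@complex.Im R).

Definition Cintegral F : R[i] :=
  ((\int[mu]_x Rec (F x)) +i* (\int[mu]_x Imc (F x)))%C.

Definition Cintegrable F :=
  mu.-integrable setT (EFin \o Rec \o F) /\ mu.-integrable setT (EFin \o Imc \o F).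

Lemma eq_Cintegral F G : measurable_fun setT F -> measurable_fun setT G ->
  {ae mu, forall x, F x = G x} -> Cintegral F = Cintegral G.
Proof.
move=> /measurable_complexP[rF iF] /measurable_complexP[rG iG] FG.
rewrite /Cintegral /Rintegral; congr (fine _ +i* fine _)%C.
  apply: ae_eq_integral => //; try exact/measurable_EFinP.
  by apply: filterS FG => x ->.
apply: ae_eq_integral => //; try exact/measurable_EFinP.
by apply: filterS FG => x ->.
Qed.

Lemma CintegralD F G : Cintegrable F -> Cintegrable G ->
  Cintegral (fun x => F x + G x) = Cintegral F + Cintegral G.
Proof.
move=> [rF iF] [rG iG]; rewrite /Cintegral; simpc.
rewrite -!RintegralD//.
congr (_ +i* _)%C; apply: eq_Rintegral => x _; by case: (F x); case: (G x).
Qed.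

Let integrableZ c (k : X -> R) : mu.-integrable setT (EFin \o k) ->
  mu.-integrable setT (EFin \o (fun x => c * k x)).
Proof.
move=> ik; rewrite (_ : _ \o _ = fun x => (c%:E * (k x)%:E)%E)//.
exact: integrableZl.
Qed.

Lemma CintegrableZ a F : Cintegrable F -> Cintegrable (fun x => a * F x).
Proof.
case: a => a b [rF iF]; split.
  rewrite (_ : _ \o _ = (EFin \o (fun x => a * Rec (F x))%R) \-
                        (EFin \o (fun x => b * Imc (F x))%R))%E.
    by apply: integrableB => //; exact: integrableZ.
  by apply/funext => x /=; case: (F x).
rewrite (_ : _ \o _ = (EFin \o (fun x => a * Imc (F x))%R) \+
                      (EFin \o (fun x => b * Rec (F x))%R))%E.
  by apply: integrableD => //; exact: integrableZ.
by apply/funext => x /=; case: (F x).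
Qed.

Lemma CintegralZ a F : Cintegrable F ->
  Cintegral (fun x => a * F x) = a * Cintegral F.
Proof.
case: a => a b [rF iF]; rewrite /Cintegral; simpc.
rewrite -!RintegralZl// -RintegralB//; try exact: integrableZ.
rewrite -RintegralD//; try exact: integrableZ.
congr (_ +i* _)%C; apply: eq_Rintegral => x _; by case: (F x).
Qed.

Lemma Cintegral_conj F : Cintegrable F ->
  Cintegral (fun x => Num.conj (F x)) = Num.conj (Cintegral F).
Proof.
move=> [rF iF]; rewrite /Cintegral/=; congr (_ +i* _)%C.
  by apply: eq_Rintegral => x _; case: (F x).
rewrite -mulN1r -RintegralZl//.
by apply: eq_Rintegral => x _; case: (F x) => ? ? /=; rewrite mulN1r.
Qed.

End ComplexIntegral.

Section L2.
Context {d} {X : measurableType d} {R : realType}.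
Variable mu : {measure set X -> \bar R}.

Definition L2_pred : {pred L0 mu} := fun f =>
  (\int[mu]_x ((Normc.normc (f x)) ^+ 2)%:E < +oo)%E.

Lemma normc_ge0 (z : R[i]) : 0 <= Normc.normc z.
Proof. by case: z => a b; exact: sqrtr_ge0. Qed.

Lemma normc_sqr (z : R[i]) :
  Normc.normc z ^+ 2 = complex.Re z ^+ 2 + complex.Im z ^+ 2.
Proof. by case: z => a b /=; rewrite sqr_sqrtr// addr_ge0// sqr_ge0. Qed.

Lemma measurable_normc_sqr (f : L0 mu) :
  measurable_fun setT (fun x => ((Normc.normc (f x)) ^+ 2)%:E).
Proof.
have /measurable_complexP[rf i_f] := measurable_L0 f.
apply/measurable_EFinP.
rewrite (_ : (fun _ => _) = (fun x => (@complex.Re R \o f) x ^+ 2) \+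
                            (fun x => (@complex.Im R \o f) x ^+ 2)).
  by apply: measurable_funD; exact: measurable_funX.
by apply/funext => x; rewrite normc_sqr.
Qed.

Lemma L2_predP (f : L0 mu) : f \in L2_pred <->
  mu.-integrable setT (fun x => ((Normc.normc (f x)) ^+ 2)%:E).
Proof.
have E : (\int[mu]_x `|((Normc.normc (f x)) ^+ 2)%:E| =
          \int[mu]_x ((Normc.normc (f x)) ^+ 2)%:E)%E.
  by apply: eq_integral => x _; rewrite gee0_abs// lee_fin sqr_ge0.
split=> [fL|/integrableP[_]]; last by rewrite E.
by apply/integrableP; split; [exact: measurable_normc_sqr|rewrite E].
Qed.

Lemma L2_pred0 : 0 \in L2_pred.
Proof.
rewrite unfold_in /L2_pred.
rewrite [ltLHS](_ : _ = \int[mu]_x cst 0 x)%E; first by rewrite integral0 ltry.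
apply: ge0_ae_eq_integral => //; first exact: measurable_normc_sqr.
  by move=> x _; rewrite lee_fin sqr_ge0.
by apply: filterS (L0_zeroE mu) => x /= + _ => ->; rewrite Normc.normc0 expr0n.
Qed.

Lemma L2_pred_linear a (f g : L0 mu) :
  f \in L2_pred -> g \in L2_pred -> a *: f + g \in L2_pred.
Proof.
move=> /L2_predP fL /L2_predP gL; rewrite unfold_in /L2_pred.
pose h x := ((2 * Normc.normc a ^+ 2)%:E * (Normc.normc (f x) ^+ 2)%:E +
             2%:E * (Normc.normc (g x) ^+ 2)%:E)%E.
have hL : mu.-integrable setT h.
  by apply: integrableD => //; exact: integrableZl.
apply: le_lt_trans (integrable_lty measurableT hL).
apply: ae_ge0_le_integral => //.
- by move=> x _; rewrite lee_fin sqr_ge0.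
- exact: measurable_normc_sqr.
- move=> x _; rewrite /h -!EFinM -EFinD lee_fin.
  by rewrite addr_ge0 ?mulr_ge0 ?normc_ge0 ?ler0n.
- exact: (measurable_int mu hL).
- apply: filterS (L0_linearE a f g) => x -> _.
  rewrite /h -!EFinM -EFinD lee_fin -mulrA -exprMn -Normc.normcM.
  move: (a * f x) (g x) => z w; rewrite !normc_sqr.
  case: z w => [z1 z2] [w1 w2] /=.
  have := sqr_ge0 (z1 - w1); have := sqr_ge0 (z2 - w2); nra.
Qed.

Fact L2_submod_closed : submod_closed L2_pred.
Proof. by split=> [|a f g]; [exact: L2_pred0|exact: L2_pred_linear]. Qed.
HB.instance Definition _ :=
  GRing.isSubmodClosed.Build _ _ L2_pred L2_submod_closed.

Record L2 := MkL2 { L2_val :> L0 mu; L2_valP : L2_val \in L2_pred }.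
HB.instance Definition _ := [isSub for L2_val].
HB.instance Definition _ := [Choice of L2 by <:].
HB.instance Definition _ := [SubChoice_isSubLmodule of L2 by <:].

Implicit Types f g h : L2.

Definition L2_dot f g : R[i] := Cintegral mu (fun x => f x * Num.conj (g x)).

Let measurable_dot f g : measurable_fun setT (fun x => f x * Num.conj (g x)).
Proof. exact: measurable_mulC (measurable_L0 _) (measurable_conjC (measurable_L0 _)). Qed.

Lemma Cintegrable_dot f g : Cintegrable mu (fun x => f x * Num.conj (g x)).
Proof.
have /L2_predP fL := L2_valP f; have /L2_predP gL := L2_valP g.
have /measurable_complexP[rm im] := measurable_dot f g.
split; apply: le_integrable (integrableD _ fL gL) => //;
  try exact/measurable_EFinP.
  move=> x _; rewrite -EFinD/= lee_fin [leRHS]ger0_norm ?addr_ge0 ?sqr_ge0//.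
  case: (f x) => a b; case: (g x) => c e; rewrite !normc_sqr/= ler_norml.
  have := sqr_ge0 (a - c); have := sqr_ge0 (a + c).
  have := sqr_ge0 (b - e); have := sqr_ge0 (b + e).
  by move=> *; apply/andP; split; nra.
move=> x _; rewrite -EFinD/= lee_fin [leRHS]ger0_norm ?addr_ge0 ?sqr_ge0//.
case: (f x) => a b; case: (g x) => c e; rewrite !normc_sqr/= ler_norml.
have := sqr_ge0 (a - e); have := sqr_ge0 (a + e).
have := sqr_ge0 (b - c); have := sqr_ge0 (b + c).
by move=> *; apply/andP; split; nra.
Qed.

Lemma L2_dotC f g : L2_dot f g = Num.conj (L2_dot g f).
Proof.
rewrite /L2_dot -Cintegral_conj; last exact: Cintegrable_dot.
by congr Cintegral; apply/funext => x; rewrite (rmorphM Num.conj)/= conjCK mulrC.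
Qed.

Lemma L2_dotPl a f g h : L2_dot (a *: f + g) h = a * L2_dot f h + L2_dot g h.
Proof.
have fh := Cintegrable_dot f h.
rewrite /L2_dot -CintegralZ// -CintegralD//.
- apply: eq_Cintegral => //.
    apply: measurable_addC => //.
    exact: measurable_mulC (@measurable_cst _ _ X R[i] setT a) (measurable_dot _ _).
  apply: filterS (L0_linearE a (f : L0 mu) (g : L0 mu)) => x /= E.
  by rewrite [X in X * _]E mulrDl mulrA.
- exact: CintegrableZ.
- exact: Cintegrable_dot.
Qed.

Fact L2_dot_bilinear : bilinear_for
  (GRing.Scale.Law.clone _ _ ( *%R ) _)
  (GRing.Scale.Law.clone _ _ (Num.conj \; *%R ) _) L2_dot.
Proof.
split=> [h a f g|h a f g] /=; first exact: L2_dotPl.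
by rewrite [LHS]L2_dotC L2_dotPl (rmorphD Num.conj) (rmorphM Num.conj)/= -!L2_dotC.
Qed.

Lemma L2_dotE f : L2_dot f f =
  ((\int[mu]_x (Normc.normc (f x) ^+ 2)) +i* 0)%C.
Proof.
rewrite /L2_dot /Cintegral; congr (_ +i* _)%C.
  by apply: eq_Rintegral => x _; case: (f x) => a b; rewrite normc_sqr/=; ring.
rewrite (_ : (fun _ => _) = cst 0) /Rintegral ?integral0//.
by apply/funext => x; case: (f x) => a b /=; ring.
Qed.

Fact L2_dot_gt0 f : f != 0 -> 0 < L2_dot f f.
Proof.
rewrite L2_dotE ltcE/= eqxx/= => f0.
rewrite lt_neqAle Rintegral_ge0 ?andbT; last by move=> x _; rewrite sqr_ge0.
apply: contra f0 => /eqP f0; apply/eqP/val_inj/L0P.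
have /L2_predP fL := L2_valP f.
have : (\int[mu]_x `|(Normc.normc (f x) ^+ 2)%:E| = 0)%E.
  rewrite (_ : (\int[mu]_x _)%E = (\int[mu]_x (Normc.normc (f x) ^+ 2)%:E)%E).
    rewrite -[LHS]fineK; last exact: integrable_fin_num.
    by congr EFin.
  by apply: eq_integral => x _; rewrite gee0_abs// lee_fin sqr_ge0.
move=> /ae_eq_integral_abs; move/(_ measurableT (measurable_normc_sqr f)).
apply: filterS2 (L0_zeroE mu) => x z /(_ I)[/eqP].
by rewrite sqrf_eq0 => /eqP /Normc.eq0_normc ->; rewrite z.
Qed.

HB.instance Definition _ := bilinear_isBilinear.Build R[i] L2 L2 R[i]
  (GRing.Scale.Law.clone _ _ ( *%R ) _)
  (GRing.Scale.Law.clone _ _ (Num.conj \; *%R ) _) L2_dot L2_dot_bilinear.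
HB.instance Definition _ := isHermitianSesquilinear.Build R[i] L2 false Num.conj
  L2_dot (fun f g => etrans (L2_dotC f g) (esym (mul1r _))).
HB.instance Definition _ := isDotProduct.Build R[i] L2 L2_dot L2_dot_gt0.

Definition is_mult_op (u : L0 mu) (T : L2 -> L2) :=
  forall f, T f = L0_mul u f :> L0 mu.

End L2.
Arguments L2_dot {d X R} mu f g.

(* Main.v *)
(* The adjoint of [M_u] is multiplication by the conjugate of [u], so each of
   the two operator sums is multiplication by a polynomial in [|u|^2].  As [mu]
   is sigma-finite, testing a multiplication operator on indicators of sets of
   finite measure shows that it vanishes only if its symbol is a.e. zero. *)
Require Import Defs.
From mathcomp Require Import all_boot all_order all_algebra.
From mathcomp Require Import all_classical all_reals all_analysis.
From mathcomp Require Import measurable_realfun complex.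

Set Implicit Arguments.
Unset Strict Implicit.
Unset Printing Implicit Defensive.

Import Order.TTheory GRing.Theory Num.Theory.

Local Open Scope classical_set_scope.
Local Open Scope ring_scope.

Lemma subr1XnE (A : comPzRingType) (m : nat) (a : A) :
  (a - 1) ^+ m = \sum_(k < m.+1) (-1) ^+ (m - k) * 'C(m, k)%:R * a ^+ k.
Proof.
(* [exprDn] gives the exponent [m - k] to the first summand, so -1 is moved to the front. *)
rewrite addrC exprDn; apply: eq_bigr => k _.
by rewrite -mulr_natr -!mulrA [a ^+ k * _]mulrC.
Qed.

Lemma normX2_subr1XnE (A : numDomainType) (m : nat) (z : A) :
  (`|z| ^+ 2 - 1) ^+ m =
  \sum_(k < m.+1) (-1) ^+ (m - k) * 'C(m, k)%:R * `|z| ^+ (2 * k).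
Proof. by rewrite subr1XnE; apply: eq_bigr => k _; rewrite exprM. Qed.

Lemma normX2_mul_subr1XnE (A : numDomainType) (m : nat) (z : A) :
  `|z| ^+ 2 * (`|z| ^+ 2 - 1) ^+ m =
  \sum_(k < m.+1) (-1) ^+ (m - k) * 'C(m, k)%:R * `|z| ^+ (2 * k.+1).
Proof.
rewrite normX2_subr1XnE mulr_sumr; apply: eq_bigr => k _.
by rewrite mulnS exprD mulrCA.
Qed.

Section Multiplication.
Context {d} {X : measurableType d} {R : realType}.
Variable mu : {measure set X -> \bar R}.
Implicit Types (T S : L2 mu -> L2 mu) (v w : X -> R[i]) (f g : L2 mu).

(** The symbol [v] is a plain function and the equation is only a.e., so that products, powers and
    sums of symbols can be formed pointwise, without passing to classes. *)
Definition multiplies v T := forall f, {ae mu, forall x, T f x = v x * f x}.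

Lemma multiplies_comp v w T S : multiplies v T -> multiplies w S ->
  multiplies (fun x => v x * w x) (T \o S).
Proof.
move=> vT wS f; apply: filterS2 (vT (S f)) (wS f) => x /= -> ->.
by rewrite mulrA.
Qed.

Lemma multiplies_iter v T k :
  multiplies v T -> multiplies (fun x => v x ^+ k) (iter k T).
Proof.
move=> vT; elim: k => [|k IH] f; first by apply: aeW => x /=; rewrite mul1r.
by apply: filterS (multiplies_comp vT IH f) => x /= ->; rewrite exprS.
Qed.

Lemma multiplies_sum n (a : 'I_n -> R[i]) (v : 'I_n -> X -> R[i])
    (T : 'I_n -> L2 mu -> L2 mu) : (forall k, multiplies (v k) (T k)) ->
  multiplies (fun x => \sum_(k < n) a k * v k x)
             (fun f => \sum_(k < n) a k *: T k f).
Proof.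
move=> vT f; elim: (index_enum _) => [|k r IH].
  (* The zero of [L2 mu] is by conversion the class [L0_zero], whose representative vanishes only
     a.e. *)
  by apply: filterS (L0_zeroE mu) => x E; rewrite !big_nil mul0r -[RHS]E.
have := L0_linearE (a k) (T k f : L0 mu) (\sum_(j <- r) a j *: T j f : L2 mu).
apply: filterS3 IH (vT k f) => x IH E D.
by rewrite !big_cons mulrDl -mulrA -E -IH -[RHS]D.
Qed.

(** These are the test functions for [multiplies_eq0]: the squared modulus of an indicator is the
    indicator itself, so its integral is [mu A], which is finite. *)
Lemma L2_indic (A : set X) : measurable A -> (mu A < +oo)%E ->
  exists f, {ae mu, forall x, f x = (\1_A x)%:C%C}.
Proof.
move=> mA Aoo.
have mf : measurable_fun setT (fun x => (\1_A x)%:C%C : R[i]).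
  apply/measurable_complexP; split; first exact: measurable_indic.
  exact: measurable_cst.
have fE := L0_classE mu mf.
suff fL : L0_class mu mf \in @L2_pred _ _ _ mu by exists (MkL2 fL).
rewrite unfold_in /L2_pred.
rewrite [ltLHS](_ : _ = \int[mu]_x (\1_A x)%:E)%E.
  by rewrite integral_indic// setIT.
apply: ge0_ae_eq_integral => //.
- exact: measurable_normc_sqr.
- exact/measurable_EFinP/measurable_indic.
- by move=> x _; rewrite lee_fin sqr_ge0.
- apply: filterS fE => x -> _; rewrite normc_sqr/= expr0n addr0.
  by rewrite indicE; case: (_ \in _); rewrite ?expr1n ?expr0n.
Qed.

Lemma multiplies_eq0 v T : sigma_finite setT mu -> multiplies v T ->
  (forall f, T f = 0) <-> {ae mu, forall x, v x = 0}.
Proof.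
move=> [F FT Ffin] vT; split=> [T0|v0 f]; last first.
  apply/val_inj/L0P; apply: filterS3 (vT f) v0 (L0_zeroE mu) => x -> -> E.
  by rewrite mul0r; exact: esym E.
(* Applied to the indicator of [F n], [T] gives a function equal to [v] a.e. on [F n], so [v] is
   a.e. zero there. The countably many exceptional null sets have a null union. *)
have /ae_foralln : forall n, {ae mu, forall x, F n x -> v x = 0}.
  move=> n; have [mF Foo] := Ffin n.
  have [f fE] := L2_indic mF Foo.
  apply: filterS3 (vT f) fE (L0_zeroE mu) => x + fx E Fx.
  rewrite fx T0 indicE mem_set// mulr1 => <-.
  exact: E.
apply: filterS => x vF.
by have [n _ /vF] : (\bigcup_n F n) x by rewrite -FT.
Qed.

Variables (u : L0 mu) (Mu : L2 mu -> L2 mu).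
Hypothesis MuE : is_mult_op u Mu.

Lemma multiplies_mult_op : multiplies u Mu.
Proof. by move=> f; rewrite MuE; exact: L0_mulE. Qed.

Lemma multiplies_adjoint :
  multiplies (fun x => Num.conj (u x)) (adjoint (L2_dot mu) Mu).
Proof.
have mh f : measurable_fun setT (fun x => Num.conj (u x) * f x).
  by apply: measurable_mulC (measurable_L0 _); exact/measurable_conjC/measurable_L0.
(* The product of [f] with the conjugate of [u] has a.e. the same modulus as [Mu f], which is
   already in L2. *)
have hL f : L0_class mu (mh f) \in @L2_pred _ _ _ mu.
  have := L2_valP (Mu f); rewrite !unfold_in /L2_pred; congr (_ < _)%E.
  apply: ge0_ae_eq_integral => //; try exact: measurable_normc_sqr.
  - by move=> x _; rewrite lee_fin sqr_ge0.
  - by move=> x _; rewrite lee_fin sqr_ge0.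
  apply: filterS2 (multiplies_mult_op f) (L0_classE mu (mh f)) => x -> -> _.
  by rewrite !Normc.normcM; case: (u x) => a b /=; rewrite sqrrN.
pose S f : L2 mu := MkL2 (hL f).
have SE : multiplies (fun x => Num.conj (u x)) S by move=> f; exact: L0_classE.
(* Adjoints are unique, so it is enough that [S] satisfies the adjoint identity; there the two
   integrands agree a.e. *)
rewrite (@adjointE _ _ (L2_dot mu) _ S)// => f g.
apply: eq_Cintegral.
- exact: measurable_mulC (measurable_L0 _) (measurable_conjC (measurable_L0 _)).
- exact: measurable_mulC (measurable_L0 _) (measurable_conjC (measurable_L0 _)).
apply: filterS2 (multiplies_mult_op f) (SE g) => x -> ->.
by rewrite (rmorphM Num.conj)/= conjCK mulrCA mulrA.
Qed.

(** The two iterates have as symbols the k-th powers of the conjugate of [u] and of [u], and a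
    number times its conjugate is its squared modulus. *)
Lemma multiplies_adjoint_iter k :
  multiplies (fun x => `|u x| ^+ (2 * k))
    (iter k (adjoint (L2_dot mu) Mu) \o iter k Mu).
Proof.
have := multiplies_comp (multiplies_iter k multiplies_adjoint)
  (multiplies_iter k multiplies_mult_op).
by move=> + f => /(_ f); apply: filterS => x ->; rewrite exprM normCKC exprMn.
Qed.

End Multiplication.

Theorem corollary2p3 (R : realType) (d : measure_display) (X : measurableType d)
    (mu : {measure set X -> \bar R})
    (mu_complete : measure_is_complete mu) (mu_sigma_finite : sigma_finite setT mu)
    (L2_infinite : infinite_dimensional (L2 mu))
    (u : L0 mu) (Mu : {linear L2 mu -> L2 mu}) (MuE : is_mult_op u Mu)
    (Mu_bounded : bounded_op (L2_dot mu) Mu)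
    (m : nat) (m_ge1 : (1 <= m)%N) :
  ((m_isometry (L2_dot mu) m Mu <->
    {ae mu, forall x,
      (`|u x| ^+ 2 - 1) ^+ m =
        \sum_(k < m.+1) (-1) ^+ (m - k) * 'C(m, k)%:R * `|u x| ^+ (2 * k) /\
      \sum_(k < m.+1) (-1) ^+ (m - k) * 'C(m, k)%:R * `|u x| ^+ (2 * k) = 0}) /\
   ({ae mu, forall x,
      (`|u x| ^+ 2 - 1) ^+ m =
        \sum_(k < m.+1) (-1) ^+ (m - k) * 'C(m, k)%:R * `|u x| ^+ (2 * k) /\
      \sum_(k < m.+1) (-1) ^+ (m - k) * 'C(m, k)%:R * `|u x| ^+ (2 * k) = 0} <->
    {ae mu, forall x, `|u x| = 1}))
  /\
  ((quasi_m_isometry (L2_dot mu) m Mu <->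
    {ae mu, forall x,
      `|u x| ^+ 2 * (`|u x| ^+ 2 - 1) ^+ m =
        \sum_(k < m.+1) (-1) ^+ (m - k) * 'C(m, k)%:R * `|u x| ^+ (2 * k.+1) /\
      \sum_(k < m.+1) (-1) ^+ (m - k) * 'C(m, k)%:R * `|u x| ^+ (2 * k.+1) = 0}) /\
   ({ae mu, forall x,
      `|u x| ^+ 2 * (`|u x| ^+ 2 - 1) ^+ m =
        \sum_(k < m.+1) (-1) ^+ (m - k) * 'C(m, k)%:R * `|u x| ^+ (2 * k.+1) /\
      \sum_(k < m.+1) (-1) ^+ (m - k) * 'C(m, k)%:R * `|u x| ^+ (2 * k.+1) = 0} <->
    {ae mu, forall x, `|u x| * (1 - `|u x| ^+ 2) = 0})).
Proof.
have MT := multiplies_adjoint_iter MuE.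
split; split.
- apply: iff_trans (multiplies_eq0 mu_sigma_finite
    (multiplies_sum (fun k : 'I_m.+1 => (-1) ^+ (m - k) * 'C(m, k)%:R)
      (fun k => MT k))) _.
  (* The first conjunct is the binomial identity, true at every point; only the vanishing of the sum
     has content. *)
  by split; apply: filterS => x; [rewrite normX2_subr1XnE|case].
- split; apply: filterS => x.
    (* As [m] is positive, the m-th power vanishes exactly when its base does; a nonnegative number
       with square 1 is 1. *)
    rewrite -normX2_subr1XnE => -[_ /eqP]; rewrite expf_eq0 m_ge1/= subr_eq0.
    by rewrite sqrp_eq1// => /eqP.
  by rewrite -normX2_subr1XnE => ->; rewrite expr1n subrr expr0n eqn0Ngt m_ge1.
- apply: iff_trans (multiplies_eq0 mu_sigma_finite
    (multiplies_sum (fun k : 'I_m.+1 => (-1) ^+ (m - k) * 'C(m, k)%:R)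
      (* The k-th term of the quasi sum has [k.+1] iterates on each side, whence the extra factor of
         the squared modulus. *)
      (fun k => MT k.+1))) _.
  by split; apply: filterS => x; [rewrite normX2_mul_subr1XnE|case].
- split; apply: filterS => x; rewrite -normX2_mul_subr1XnE.
    (* Both conditions say that at almost every point the modulus of [u] is 0 or has square 1. *)
    move=> [_ /eqP]; rewrite mulf_eq0 !expf_eq0 m_ge1/= => /orP[/eqP ->|].
      by rewrite mul0r.
    by rewrite subr_eq0 => /eqP ->; rewrite subrr mulr0.
  move=> /eqP; rewrite mulf_eq0 => /orP[/eqP ->|].
    by rewrite expr0n mul0r.
  rewrite subr_eq0 => /eqP <-.
  by rewrite subrr expr0n eqn0Ngt m_ge1 mulr0.
Qed.
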